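(* Let $\mathcal{G}$ be an ultragraph and $R$ a unital commutative ring. Then the $R$-algebras $L_R(\mathcal{G}_r)$ and $L_R(\mathcal{G})$ are isomorphic.
   Context: An ultragraph is a quadruple $\mathcal{G}=(G^0,\mathcal{G}^1,r,s)$ with $G^0,\mathcal{G}^1$ countable sets, $s:\mathcal{G}^1\to G^0$, $r:\mathcal{G}^1\to P(G^0)\setminus\{\emptyset\}$ ($P$ = power set). $\mathcal{G}^0\subseteq P(G^0)$ is the smallest family containing $\emptyset$, all $\{v\}$ ($v\in G^0$), all $r(e)$ ($e\in\mathcal{G}^1$), and closed under finite unions and finite intersections (closure under relative complements is not required). $\mathcal{B}$ is the smallest family of subsets of $G^0$ containing $\mathcal{G}^0$ and closed under relative complements, finite unions and finite intersections. The Leavitt path algebra $L_R(\mathcal{G})$ is the universal (not necessarily unital) $R$-algebra with generators $\{s_e,s_e^*:e\in\mathcal{G}^1\}\cup\{p_A:A\in\mathcal{G}^0\}$ and relations: (1) $p_\emptyset=0$, $p_Ap_B=p_{A\cap B}$, $p_{A\cup B}=p_A+p_B-p_{A\cap B}$ for all $A,B\in\mathcal{G}^0$; (2) $p_{s(e)}s_e=s_ep_{r(e)}=s_e$ and $p_{r(e)}s_e^*=s_e^*p_{s(e)}=s_e^*$ for $e\in\mathcal{G}^1$; (3) $s_e^*s_f=\delta_{e,f}p_{r(e)}$ for $e,f\in\mathcal{G}^1$; (4) $p_v=\sum_{s(e)=v}s_es_e^*$ whenever $0<|s^{-1}(v)|<\infty$. Here $p_v=p_{\{v\}}$. $L_R(\mathcal{G}_r)$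 is defined by the same generators and relations, except that $\mathcal{G}^0$ is replaced by $\mathcal{B}$: there is a generator $p_A$ for each $A\in\mathcal{B}$, and (1) is imposed for all $A,B\in\mathcal{B}$. *)

(* Defs.v *)
From HB Require Import structures.
From mathcomp Require Import all_boot all_order all_algebra generic_quotient.
From mathcomp Require Import finmap.
From mathcomp Require Import boolp classical_sets functions cardinality.
From mathcomp Require Import measurable_structure.

Set Implicit Arguments.
Unset Strict Implicit.
Unset Printing Implicit Defensive.

Import GRing.Theory.
Local Open Scope classical_set_scope.
Local Open Scope ring_scope.
Local Open Scope quotient_scope.

(* Associative, not necessarily unital, algebras. *)
HB.mixin Record Lmodule_isNuAlgebra (R : comPzRingType) A
    of GRing.Lmodule R A := {
  numul : A -> A -> A;
  numulA : associative numul;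
  numulDl : left_distributive numul +%R;
  numulDr : right_distributive numul +%R;
  numulZl : forall (k : R) (x y : A), numul (k *: x) y = k *: numul x y;
  numulZr : forall (k : R) (x y : A), numul x (k *: y) = k *: numul x y
}.

#[short(type="nuAlgType")]
HB.structure Definition NuAlgebra (R : comPzRingType) :=
  {A of Lmodule_isNuAlgebra R A & GRing.Lmodule R A}.

Definition nualg_hom (R : comPzRingType) (A B : nuAlgType R) (f : A -> B) :
  Prop := linear f /\ {morph f : x y / numul x y}.

Definition nualg_isomorphic (R : comPzRingType) (A B : nuAlgType R) : Prop :=
  exists f : A -> B, nualg_hom f /\ bijective f.

(* The non-unital R-algebra presented by generators X and relations rels:
   formal expressions modulo the congruence generated by the algebra axioms
   and rels. *)
Inductive expr (R : comPzRingType) (X : Type) : Type :=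
| TGen (x : X)
| TZero
| TOpp (t : expr R X)
| TAdd (t u : expr R X)
| TScale (k : R) (t : expr R X)
| TMul (t u : expr R X).

Arguments TGen {R X} x.
Arguments TZero {R X}.

Declare Scope expr_scope.
Delimit Scope expr_scope with expr.
Bind Scope expr_scope with expr.
Notation "0" := TZero : expr_scope.
Notation "- t" := (TOpp t) : expr_scope.
Notation "t + u" := (TAdd t u) : expr_scope.
Notation "t - u" := (TAdd t (TOpp u)) : expr_scope.
Notation "k *: t" := (TScale k t) : expr_scope.
Notation "t * u" := (TMul t u) : expr_scope.

Section Presentation.
Variables (R : comPzRingType) (X : Type).
Implicit Types (t u v w : expr R X) (k l : R).

HB.instance Definition _ := gen_eqMixin (expr R X).
HB.instance Definition _ := gen_choiceMixin (expr R X).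

Variable rels : expr R X -> expr R X -> Prop.

Inductive cong : expr R X -> expr R X -> Prop :=
| cong_rel t u : rels t u -> cong t u
| cong_refl t : cong t t
| cong_sym t u : cong t u -> cong u t
| cong_trans t u v : cong t u -> cong u v -> cong t v
| congN t u : cong t u -> cong (- t) (- u)
| congD t u v w : cong t u -> cong v w -> cong (t + v) (u + w)
| congZ k t u : cong t u -> cong (k *: t) (k *: u)
| congM t u v w : cong t u -> cong v w -> cong (t * v) (u * w)
| cong_addA t u v : cong (t + (u + v)) (t + u + v)
| cong_addC t u : cong (t + u) (u + t)
| cong_add0 t : cong (0 + t) t
| cong_addN t : cong (- t + t) 0
| cong_scaleA k l t : cong (k *: (l *: t)) ((k * l)%R *: t)
| cong_scale1 t : cong (1%R *: t) t
| cong_scaleDr k t u : cong (k *: (t + u)) (k *: t + k *: u)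
| cong_scaleDl k l t : cong ((k + l)%R *: t) (k *: t + l *: t)
| cong_mulA t u v : cong (t * (u * v)) (t * u * v)
| cong_mulDl t u v : cong ((t + u) * v) (t * v + u * v)
| cong_mulDr t u v : cong (t * (u + v)) (t * u + t * v)
| cong_mulZl k t u : cong ((k *: t) * u) (k *: (t * u))
| cong_mulZr k t u : cong (t * (k *: u)) (k *: (t * u)).

Definition congb t u : bool := `[< cong t u >].

Lemma congb_equiv : equiv_class_of congb.
Proof.
split=> [t|t u|u t v].
- exact/asboolP/cong_refl.
- by apply: asbool_equiv_eq; split; apply: cong_sym.
- by move=> /asboolP tu /asboolP uv; apply/asboolP; exact: cong_trans uv.
Qed.

Canonical congb_equivRel := EquivRelPack congb_equiv.

Definition presAlg := {eq_quot congb}.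
HB.instance Definition _ := Choice.on presAlg.
HB.instance Definition _ := EqQuotient.on presAlg.

Definition pi_pres (t : expr R X) : presAlg := \pi_presAlg t.

Definition pres_gen (x : X) : presAlg := pi_pres (TGen x).

Lemma pi_presP t u : pi_pres t = pi_pres u <-> cong t u.
Proof.
split=> [/eqmodP/asboolP//|tu]; exact/eqmodP/asboolP.
Qed.

Lemma pi_pres_repr (a : presAlg) : pi_pres (repr a) = a.
Proof. exact: reprK. Qed.

Lemma cong_repr t : cong (repr (pi_pres t)) t.
Proof. by apply/pi_presP; rewrite pi_pres_repr. Qed.

Definition pres_zero : presAlg := pi_pres 0.
Definition pres_opp (a : presAlg) : presAlg := pi_pres (- repr a).
Definition pres_add (a b : presAlg) : presAlg := pi_pres (repr a + repr b).
Definition pres_scale k (a : presAlg) : presAlg := pi_pres (k *: repr a).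
Definition pres_mul (a b : presAlg) : presAlg := pi_pres (repr a * repr b).

Lemma pres_oppE t : pres_opp (pi_pres t) = pi_pres (- t).
Proof. exact/pi_presP/congN/cong_repr. Qed.
Lemma pres_addE t u : pres_add (pi_pres t) (pi_pres u) = pi_pres (t + u).
Proof. by apply/pi_presP/congD; exact: cong_repr. Qed.
Lemma pres_scaleE k t : pres_scale k (pi_pres t) = pi_pres (k *: t).
Proof. exact/pi_presP/congZ/cong_repr. Qed.
Lemma pres_mulE t u : pres_mul (pi_pres t) (pi_pres u) = pi_pres (t * u).
Proof. by apply/pi_presP/congM; exact: cong_repr. Qed.

Let presE := (pres_oppE, pres_addE, pres_scaleE, pres_mulE).

Lemma pres_ind (P : presAlg -> Prop) : (forall t, P (pi_pres t)) -> forall a, P a.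
Proof. by move=> Pt a; rewrite -[a]pi_pres_repr. Qed.

Lemma pres_addrA : associative pres_add.
Proof.
elim/pres_ind=> t; elim/pres_ind=> u; elim/pres_ind=> v; rewrite !presE.
exact/pi_presP/cong_addA.
Qed.
Lemma pres_addrC : commutative pres_add.
Proof.
elim/pres_ind=> t; elim/pres_ind=> u; rewrite !presE.
exact/pi_presP/cong_addC.
Qed.
Lemma pres_add0r : left_id pres_zero pres_add.
Proof. elim/pres_ind=> t; rewrite !presE; exact/pi_presP/cong_add0. Qed.
Lemma pres_addNr : left_inverse pres_zero pres_opp pres_add.
Proof. elim/pres_ind=> t; rewrite !presE; exact/pi_presP/cong_addN. Qed.

HB.instance Definition _ := GRing.isZmodule.Build presAlg
  pres_addrA pres_addrC pres_add0r pres_addNr.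

Lemma pres_scalerA k l (a : presAlg) :
  pres_scale k (pres_scale l a) = pres_scale (k * l)%R a.
Proof. elim/pres_ind: a => t; rewrite !presE; exact/pi_presP/cong_scaleA. Qed.
Lemma pres_scale1r : left_id 1%R pres_scale.
Proof. elim/pres_ind=> t; rewrite !presE; exact/pi_presP/cong_scale1. Qed.
Lemma pres_scalerDr : right_distributive pres_scale +%R.
Proof.
move=> k; elim/pres_ind=> t; elim/pres_ind=> u.
rewrite /GRing.add/= !presE; exact/pi_presP/cong_scaleDr.
Qed.
Lemma pres_scalerDl (a : presAlg) : {morph pres_scale^~ a : k l / (k + l)%R}.
Proof.
elim/pres_ind: a => t k l; rewrite {2}/GRing.add/= !presE.
exact/pi_presP/cong_scaleDl.
Qed.

HB.instance Definition _ := GRing.Zmodule_isLmodule.Build R presAlg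
  pres_scalerA pres_scale1r pres_scalerDr pres_scalerDl.

Lemma pres_mulrA : associative pres_mul.
Proof.
elim/pres_ind=> t; elim/pres_ind=> u; elim/pres_ind=> v; rewrite !presE.
exact/pi_presP/cong_mulA.
Qed.
Lemma pres_mulrDl : left_distributive pres_mul +%R.
Proof.
elim/pres_ind=> t; elim/pres_ind=> u; elim/pres_ind=> v.
rewrite /GRing.add/= !presE; exact/pi_presP/cong_mulDl.
Qed.
Lemma pres_mulrDr : right_distributive pres_mul +%R.
Proof.
elim/pres_ind=> t; elim/pres_ind=> u; elim/pres_ind=> v.
rewrite /GRing.add/= !presE; exact/pi_presP/cong_mulDr.
Qed.
Lemma pres_mulZl k (a b : presAlg) : pres_mul (k *: a)%R b = (k *: pres_mul a b)%R.
Proof.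
elim/pres_ind: a => t; elim/pres_ind: b => u.
rewrite /GRing.scale/= !presE; exact/pi_presP/cong_mulZl.
Qed.
Lemma pres_mulZr k (a b : presAlg) : pres_mul a (k *: b)%R = (k *: pres_mul a b)%R.
Proof.
elim/pres_ind: a => t; elim/pres_ind: b => u.
rewrite /GRing.scale/= !presE; exact/pi_presP/cong_mulZr.
Qed.

HB.instance Definition _ := Lmodule_isNuAlgebra.Build R presAlg
  pres_mulrA pres_mulrDl pres_mulrDr pres_mulZl pres_mulZr.

Lemma pi_pres0 : pi_pres 0 = 0%R. Proof. by []. Qed.
Lemma pi_presN t : pi_pres (- t) = (- pi_pres t)%R.
Proof. by rewrite [RHS]pres_oppE. Qed.
Lemma pi_presD t u : pi_pres (t + u) = (pi_pres t + pi_pres u)%R.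
Proof. by rewrite [RHS]pres_addE. Qed.
Lemma pi_presZ k t : pi_pres (k *: t) = (k *: pi_pres t)%R.
Proof. by rewrite [RHS]pres_scaleE. Qed.
Lemma pi_presM t u : pi_pres (t * u) = numul (pi_pres t) (pi_pres u).
Proof. by rewrite [RHS]pres_mulE. Qed.

End Presentation.

Fixpoint eval (R : comPzRingType) (X : Type) (A : nuAlgType R) (g : X -> A)
    (t : expr R X) : A :=
  match t with
  | TGen x => g x
  | TZero => 0
  | TOpp t => - eval g t
  | TAdd t u => eval g t + eval g u
  | TScale k t => k *: eval g t
  | TMul t u => numul (eval g t) (eval g u)
  end.

Lemma pi_pres_eval (R : comPzRingType) (X : Type)
    (rels : expr R X -> expr R X -> Prop) (t : expr R X) :
  pi_pres rels t = eval (pres_gen rels) t.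
Proof.
elim: t => [x||t IHt|t IHt u IHu|k t IHt|t IHt u IHu] //=.
- by rewrite pi_presN IHt.
- by rewrite pi_presD IHt IHu.
- by rewrite pi_presZ IHt.
- by rewrite pi_presM IHt IHu.
Qed.

Lemma pres_gen_rels (R : comPzRingType) (X : Type)
    (rels : expr R X -> expr R X -> Prop) (t u : expr R X) :
  rels t u -> eval (pres_gen rels) t = eval (pres_gen rels) u.
Proof. by move=> tu; rewrite -!pi_pres_eval; apply/pi_presP/cong_rel. Qed.

Lemma nualg_hom_eval (R : comPzRingType) (X : Type) (A B : nuAlgType R)
    (f : A -> B) (g : X -> A) (t : expr R X) :
  nualg_hom f -> f (eval g t) = eval (f \o g) t.
Proof.
move=> [lf mf].
have fD x y : f (x + y) = f x + f y by have := lf 1 x y; rewrite !scale1r.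
have f0 : f 0 = 0 by apply: (addrI (f 0)); rewrite -fD !addr0.
have fZ k x : f (k *: x) = k *: f x by have := lf k x 0; rewrite f0 !addr0.
have fN x : f (- x) = - f x by rewrite -!scaleN1r fZ.
elim: t => [x||t IHt|t IHt u IHu|k t IHt|t IHt u IHu] //=.
- by rewrite fN IHt.
- by rewrite fD IHt IHu.
- by rewrite fZ IHt.
- by rewrite mf IHt IHu.
Qed.

Lemma presAlg_universal (R : comPzRingType) (X : Type)
    (rels : expr R X -> expr R X -> Prop) (A : nuAlgType R) (g : X -> A) :
  (forall t u, rels t u -> eval g t = eval g u) ->
  exists! f : presAlg rels -> A,
    nualg_hom f /\ forall x, f (pres_gen rels x) = g x.
Proof.
move=> gP.
have gC t u : cong rels t u -> eval g t = eval g u.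
  elim=> //=.
  - by move=> ? ? ? _ -> _ ->.
  - by move=> ? ? _ ->.
  - by move=> ? ? ? ? _ -> _ ->.
  - by move=> ? ? ? _ ->.
  - by move=> ? ? ? ? _ -> _ ->.
  - by move=> *; rewrite addrA.
  - by move=> *; rewrite addrC.
  - by move=> *; rewrite add0r.
  - by move=> *; rewrite addNr.
  - by move=> *; rewrite scalerA.
  - by move=> *; rewrite scale1r.
  - by move=> *; rewrite scalerDr.
  - by move=> *; rewrite scalerDl.
  - by move=> *; rewrite numulA.
  - by move=> *; rewrite numulDl.
  - by move=> *; rewrite numulDr.
  - by move=> *; rewrite numulZl.
  - by move=> *; rewrite numulZr.
pose f (a : presAlg rels) : A := eval g (repr a).
have fE t : f (pi_pres rels t) = eval g t by exact/gC/cong_repr.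
exists f; split=> [|h [hh hg]].
  split; last by move=> x; rewrite [LHS]fE.
  split=> [k a b|a b]; elim/pres_ind: a => t; elim/pres_ind: b => u.
    by rewrite -pi_presZ -pi_presD !fE.
  by rewrite -pi_presM !fE.
apply/funext; elim/pres_ind=> t.
rewrite fE pi_pres_eval (nualg_hom_eval _ _ hh).
by congr (eval _ t); apply/funext=> x /=; rewrite hg.
Qed.

Record ultragraph := Ultragraph {
  vertex : countType;
  edge : countType;
  src : edge -> vertex;
  rng : edge -> set vertex;
  rng_neq0 : forall e, rng e !=set0
}.

(* A family F of vertex sets to index the generators p_A: both \mathcal{G}^0
   (calG0) and \mathcal{B} (calB) are instances. *)
Record setFamily (G : ultragraph) := SetFamily {
  members : set (set (vertex G));
  fam0 : members set0;
  fam1 : forall v, members [set v];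
  fam_rng : forall e, members (rng e);
  famU : setU_closed members;
  famI : setI_closed members
}.

Section Families.
Variable G : ultragraph.

Definition basic_sets : set (set (vertex G)) :=
  [set set0] `|` range set1 `|` range (@rng G).

Definition calG0 : set (set (vertex G)) :=
  smallest [set M | setU_closed M /\ setI_closed M] basic_sets.

Definition calB : set (set (vertex G)) :=
  smallest [set M | [/\ setD_closed M, setU_closed M & setI_closed M]] calG0.

Lemma calG0_basic : basic_sets `<=` calG0.
Proof. exact: sub_gen_smallest. Qed.
Lemma calG0_0 : calG0 set0.
Proof. by apply: calG0_basic; left; left. Qed.
Lemma calG0_1 v : calG0 [set v].
Proof. by apply: calG0_basic; left; right; exists v. Qed.
Lemma calG0_rng e : calG0 (rng e).
Proof. by apply: calG0_basic; right; exists e. Qed.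
Lemma calG0_U : setU_closed calG0.
Proof. by move=> A B hA hB M MP; exact: MP.1.1 (hA _ MP) (hB _ MP). Qed.
Lemma calG0_I : setI_closed calG0.
Proof. by move=> A B hA hB M MP; exact: MP.1.2 (hA _ MP) (hB _ MP). Qed.

Lemma calG0_calB : calG0 `<=` calB.
Proof. exact: sub_gen_smallest. Qed.
Lemma calB_D : setD_closed calB.
Proof.
move=> A B hA hB M MP; case: (MP) => -[MD MU MI] _.
exact: MD (hA _ MP) (hB _ MP).
Qed.
Lemma calB_U : setU_closed calB.
Proof.
move=> A B hA hB M MP; case: (MP) => -[MD MU MI] _.
exact: MU (hA _ MP) (hB _ MP).
Qed.
Lemma calB_I : setI_closed calB.
Proof.
move=> A B hA hB M MP; case: (MP) => -[MD MU MI] _.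
exact: MI (hA _ MP) (hB _ MP).
Qed.

Definition famG0 : setFamily G :=
  SetFamily calG0_0 calG0_1 calG0_rng calG0_U calG0_I.

Definition famB : setFamily G :=
  SetFamily (calG0_calB calG0_0) (fun v => calG0_calB (calG0_1 v))
    (fun e => calG0_calB (calG0_rng e)) calB_U calB_I.

End Families.

Section Leavitt.
Variables (R : comPzRingType) (G : ultragraph) (F : setFamily G).

(* By proof irrelevance there is exactly one generator p_A for each A in F. *)
Inductive generator : Type :=
| GenS (e : edge G)
| GenSs (e : edge G)
| GenP (A : set (vertex G)) (FA : members F A).

Local Notation s e := (TGen (GenS e) : expr R generator).
Local Notation "s^* e" := (TGen (GenSs e) : expr R generator)
  (at level 10, e at level 9).
Local Notation p FA := (TGen (GenP FA) : expr R generator).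

Inductive leavitt_rel : expr R generator -> expr R generator -> Prop :=
| rel_p0 : leavitt_rel (p (fam0 F)) 0
| rel_pI A B (FA : members F A) (FB : members F B) :
    leavitt_rel (p FA * p FB) (p (famI FA FB))
| rel_pU A B (FA : members F A) (FB : members F B) :
    leavitt_rel (p (famU FA FB)) (p FA + p FB - p (famI FA FB))
| rel_src_s e : leavitt_rel (p (fam1 F (src e)) * s e) (s e)
| rel_s_rng e : leavitt_rel (s e * p (fam_rng F e)) (s e)
| rel_rng_ss e : leavitt_rel (p (fam_rng F e) * s^* e) (s^* e)
| rel_ss_src e : leavitt_rel (s^* e * p (fam1 F (src e))) (s^* e)
| rel_ss_s e f :
    leavitt_rel (s^* e * s f) (if e == f then p (fam_rng F e) else 0%expr)
| rel_regular v : (@src G @^-1` [set v]) !=set0 ->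
    finite_set (@src G @^-1` [set v]) ->
    leavitt_rel (p (fam1 F v))
      (\big[@TAdd R generator/0%expr]_(e <- fset_set (@src G @^-1` [set v]))
         (s e * s^* e)%expr).

Definition leavitt_path_algebra : nuAlgType R := presAlg leavitt_rel.

End Leavitt.

Definition LPA (R : comPzRingType) (G : ultragraph) : nuAlgType R :=
  leavitt_path_algebra R (famG0 G).

(* L_R(G_r): generators p_A and relations (1) for all A in the family calB. *)
Definition LPAr (R : comPzRingType) (G : ultragraph) : nuAlgType R :=
  leavitt_path_algebra R (famB G).

(* Main.v *)
Require Import Defs.
From mathcomp Require Import all_boot all_algebra.
From mathcomp Require Import boolp classical_sets.

(** The two presentations differ only in their projections: those of
    [LPAr R G] are indexed by the ring of sets [calB G], those of [LPA R G] by
    the lattice [calG0 G] that generates it.  The theorem holds because a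
    lattice morphism [p] from a lattice [M] of sets to the idempotents of an
    algebra extends uniquely to the ring of sets generated by [M].

    An extension must satisfy p (X \ Y) = p X - p X p Y, which expresses it
    on every set of the ring; the point is that the value of p X so obtained
    does not depend on how X is written.  The predicate [indicates X a] pins
    this value down without mentioning any expression of X.  Each difference
    C \ D of members of [M] has an idempotent, [cell C D] = p C - p (C & D),
    and [indicates X a] asks that every C \ D can be cut by finitely many
    members of [M] into differences C' \ D' on which [a] acts as X does: as
    the identity if C' \ D' is inside X, as zero if it is outside; it also asks
    that p C a = a for some C in [M].  Since [cell] is additive along cuts, two
    such elements [a] and [b] agree after multiplication by any cell, and some
    cell fixes them both, so they are equal ([indicates_uniq]).  The
    relation is compatible with intersection, union and difference, so the
    sets X that have an indicating element form a ring of sets containing [M],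
    and the compatibilities together with uniqueness say that X |-> a
    satisfies the Boolean relations.

    Applied to [M] = [calG0 G] inside [LPA R G], this gives by the universal
    property a morphism from [LPAr R G] to [LPA R G]; the inclusion of
    generators gives one in the other direction, and the two are inverse to
    each other on generators. *)

Set Implicit Arguments.
Unset Strict Implicit.
Unset Printing Implicit Defensive.

Import GRing.Theory.
Local Open Scope classical_set_scope.
Local Open Scope ring_scope.

Local Infix "**" := numul (at level 40, left associativity) : ring_scope.

(** * Morphisms and evaluation *)

Section NuAlgebraTheory.
Variables (R : comPzRingType) (A : nuAlgType R).
Implicit Types x y z : A.

Lemma numul0l x : 0 ** x = 0.
Proof. by rewrite -[X in X ** _](scale0r 0) numulZl scale0r. Qed.

Lemma numul0r x : x ** 0 = 0.
Proof. by rewrite -[X in _ ** X](scale0r 0) numulZr scale0r. Qed.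

Lemma numulBl x y z : (x - y) ** z = x ** z - y ** z.
Proof. by rewrite numulDl -[- y]scaleN1r numulZl scaleN1r. Qed.

Lemma numulBr x y z : x ** (y - z) = x ** y - x ** z.
Proof. by rewrite numulDr -[- z]scaleN1r numulZr scaleN1r. Qed.

End NuAlgebraTheory.

Lemma nualg_homB (R : comPzRingType) (A B : nuAlgType R) (f : A -> B) x y :
  nualg_hom f -> f (x - y) = f x - f y.
Proof.
by case=> lf _; have := lf (-1) y x; rewrite !scaleN1r ![- _ + _]addrC.
Qed.

Lemma nualg_homD (R : comPzRingType) (A B : nuAlgType R) (f : A -> B) x y :
  nualg_hom f -> f (x + y) = f x + f y.
Proof. by case=> lf _; have := lf 1 x y; rewrite !scale1r. Qed.

Lemma nualg_hom_comp (R : comPzRingType) (A B C : nuAlgType R)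
    (f : A -> B) (h : B -> C) :
  nualg_hom f -> nualg_hom h -> nualg_hom (h \o f).
Proof.
move=> [lf mf] [lh mh].
by split=> [k x y|x y] /=; [rewrite lf lh | rewrite mf mh].
Qed.

Lemma nualg_hom_pres_id (R : comPzRingType) (X : Type)
    (rels : expr R X -> expr R X -> Prop) (f : presAlg rels -> presAlg rels) :
  nualg_hom f -> (forall x, f (pres_gen rels x) = pres_gen rels x) ->
  f =1 id.
Proof.
move=> fH fg; elim/pres_ind=> t; rewrite pi_pres_eval (nualg_hom_eval _ _ fH).
by congr (eval _ t); apply/funext=> x; exact: fg.
Qed.

Lemma eval_sum (R : comPzRingType) (X : Type) (A : nuAlgType R) (g : X -> A)
    (I : Type) (r : seq I) (F : I -> expr R X) :
  eval g (\big[@TAdd R X/TZero]_(i <- r) F i) = \sum_(i <- r) eval g (F i).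
Proof. exact: (big_morph (eval g)). Qed.

(** * Extending a lattice morphism to the generated ring of sets *)

Section Extension.
Variables (T : Type) (M : set (set T)).
Hypotheses (M0 : M set0) (MU : setU_closed M) (MI : setI_closed M).
Variables (R : comPzRingType) (L : nuAlgType R) (p : set T -> L).
Hypotheses (p0 : p set0 = 0)
  (pI : forall A B, M A -> M B -> p A ** p B = p (A `&` B))
  (pU : forall A B, M A -> M B -> p (A `|` B) = p A + p B - p (A `&` B)).
Implicit Types (A B C D X Y : set T) (a b : L).

(** The idempotent that any extension of [p] takes on C \ D. *)
Definition cell C D : L := p C - p (C `&` D).

Lemma cell0r C : cell C set0 = p C.
Proof. by rewrite /cell setI0 p0 subr0. Qed.

Lemma cell_eq0 C D : C `\` D `<=` set0 -> cell C D = 0.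
Proof.
move=> CD; have /setIidPl CsD : C `<=` D.
  by move=> x Cx; apply: contrapT => Dx; exact: (CD x).
by rewrite /cell CsD subrr.
Qed.

Lemma cellM A C D : M A -> M C -> M D -> p A ** cell C D = cell (C `&` A) D.
Proof.
move=> MA MC MD; rewrite numulBr !pI //; last exact: MI.
by rewrite /cell setIA [A `&` C]setIC.
Qed.

Lemma cell_cut A C D : M A -> M C -> M D ->
  cell C D = cell (C `&` A) D + cell C (D `|` A).
Proof.
move=> MA MC MD; rewrite /cell setIUr pU; try exact: MI.
rewrite setIACA setIid [D `&` A]setIC setIA -[p _ + p _ - p _]addrA.
by rewrite opprD addrCA [- _ - _]addrC addNKr.
Qed.

(** A cut by A splits C \ D into the part inside A and the part outside A, both
    again differences of members of [M]. *)
Inductive dissected (P : set T -> set T -> Prop) C D : Prop :=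
| dissected_leaf of P C D
| dissected_cut A of M A & dissected P (C `&` A) D & dissected P C (D `|` A).

(** The position of C \ D relative to X is recorded next to the action of [a]
    because it makes two elements comparable: if [a] and [b] both decide X on
    C \ D, one acting as the identity and the other as zero, then C \ D is
    empty and [cell C D] vanishes. *)
Definition decides X a C D : Prop :=
  (C `\` D `<=` X /\ cell C D ** a = cell C D) \/
  (C `\` D `<=` ~` X /\ cell C D ** a = 0).

Lemma decides_cut X a A C D : M A -> M C -> M D -> decides X a C D ->
  decides X a (C `&` A) D /\ decides X a C (D `|` A).
Proof.
move=> MA MC MD.
have subl : (C `&` A) `\` D `<=` C `\` D by move=> x [[]].
have subr : C `\` (D `|` A) `<=` C `\` D.
  by move=> x [Cx DAx]; split=> // Dx; apply: DAx; left.
have cellr : cell C (D `|` A) = cell C D - cell (C `&` A) D.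
  by rewrite (cell_cut MA MC MD) addrC addKr.
have celll : cell (C `&` A) D = p A ** cell C D by rewrite cellM.
case=> -[CDX ea].
  have la : cell (C `&` A) D ** a = cell (C `&` A) D.
    by rewrite celll -numulA ea.
  split; left; split=> //; [exact: subset_trans CDX|exact: subset_trans CDX|].
  by rewrite cellr numulBl ea la.
have la : cell (C `&` A) D ** a = 0 by rewrite celll -numulA ea numul0r.
split; right; split=> //; [exact: subset_trans CDX|exact: subset_trans CDX|].
by rewrite cellr numulBl ea la subr0.
Qed.

(** Cutting is a refinement process: what is decided on a piece stays decided
    on smaller pieces, so dissections for X and for Y can be performed one
    after the other. *)
Lemma dissected_decides2 (P : set T -> set T -> Prop) X a Y b :
  (forall C D, M C -> M D -> dissected (decides X a) C D) ->
  (forall C D, M C -> M D -> dissected (decides Y b) C D) ->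
  (forall C D, M C -> M D -> decides X a C D -> decides Y b C D -> P C D) ->
  forall C D, M C -> M D -> dissected P C D.
Proof.
move=> dX dY XYP.
have dXP C D : dissected (decides Y b) C D -> M C -> M D ->
    decides X a C D -> dissected P C D.
  elim=> {}C {}D => [YCD|A MA _ IHl _ IHr] MC MD XCD.
    by apply: dissected_leaf; exact: XYP.
  have [Xl Xr] := decides_cut MA MC MD XCD.
  by apply: (dissected_cut MA); [apply: IHl => //; exact: MI
                                |apply: IHr => //; exact: MU].
move=> C D MC MD; move: (dX C D MC MD) (MC) (MD) => {MC MD}.
elim=> {}C {}D => [XCD|A MA _ IHl _ IHr] MC MD.
  exact: dXP (dY _ _ MC MD) _ _ _.
by apply: (dissected_cut MA); [apply: IHl => //; exact: MI
                              |apply: IHr => //; exact: MU].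
Qed.

Lemma dissected_cell_eq a b C D : M C -> M D ->
  dissected (fun C D => cell C D ** a = cell C D ** b) C D ->
  cell C D ** a = cell C D ** b.
Proof.
move=> MC MD dCD; move: dCD MC MD.
elim=> {}C {}D // A MA _ IHl _ IHr MC MD.
rewrite (cell_cut MA MC MD) [LHS]numulDl [RHS]numulDl IHl ?IHr //.
  exact: MU.
exact: MI.
Qed.

(** The value at X of any extension of [p] to a ring of sets.  The first
    clause is what makes multiplication by cells detect [a]. *)
Definition indicates X a : Prop :=
  (exists2 C, M C & p C ** a = a) /\
  (forall C D, M C -> M D -> dissected (decides X a) C D).

Lemma absorb_sub C C' a : M C -> M C' -> C `<=` C' ->
  p C ** a = a -> p C' ** a = a.
Proof. by move=> MC MC' sCC' <-; rewrite numulA pI // setIidr. Qed.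

Lemma indicates_uniq X a b : indicates X a -> indicates X b -> a = b.
Proof.
move=> [[C MC Ca] Xa] [[C' MC' C'b] Xb].
have MCC' : M (C `|` C') by exact: MU.
have CC'a := absorb_sub MC MCC' (@subsetUl _ C C') Ca.
have CC'b := absorb_sub MC' MCC' (@subsetUr _ C C') C'b.
rewrite -CC'a -CC'b -cell0r; apply: dissected_cell_eq => //.
apply: (dissected_decides2 Xa Xb) => // E D ME MD.
have emptyE : E `\` D `<=` X -> E `\` D `<=` ~` X -> cell E D = 0.
  by move=> EX EnX; apply: cell_eq0 => x EDx; exact: EnX (EX x EDx).
by move=> [[EX ea]|[EX ea]] [[EX' eb]|[EX' eb]];
  rewrite ea eb // emptyE.
Qed.

Lemma indicates_member A : M A -> indicates A (p A).
Proof.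
move=> MA; split=> [|C D MC MD]; first by exists A => //; rewrite pI ?setIid.
apply: (dissected_cut MA); apply: dissected_leaf.
  left; split; first by move=> x [[]].
  have MCA := MI MC MA; rewrite numulBl !pI //; last exact: MI.
  by rewrite [_ `&` D `&` A]setIAC -[C `&` A `&` A]setIA setIid.
right; split; first by move=> x [_ nDA] Ax; exact: nDA (or_intror Ax).
have MDA := MU MD MA.
rewrite numulBl !pI //; last exact: MI.
by rewrite -setIA (setIidr (@subsetUr _ D A)) subrr.
Qed.

Lemma indicatesI X a Y b :
  indicates X a -> indicates Y b -> indicates (X `&` Y) (a ** b).
Proof.
move=> [[C MC Ca] Xa] [_ Yb]; split; first by exists C; rewrite // numulA Ca.
apply: (dissected_decides2 Xa Yb) => {MC Ca}C D _ _.
move=> [[CX ea]|[CX ea]].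
  move=> [[CY eb]|[CY eb]]; [left|right]; rewrite numulA ea; split=> // x CDx.
    by split; [exact: CX|exact: CY].
  by move=> [_]; exact: CY.
by move=> _; right; rewrite numulA ea numul0l; split=> // x /CX nX [].
Qed.

Lemma indicatesD X a Y b :
  indicates X a -> indicates Y b -> indicates (X `\` Y) (a - a ** b).
Proof.
move=> [[C MC Ca] Xa] [_ Yb]; split.
  by exists C => //; rewrite numulBr numulA Ca.
apply: (dissected_decides2 Xa Yb) => {MC Ca}C D _ _.
move=> [[CX ea]|[CX ea]].
  move=> [[CY eb]|[CY eb]]; [right|left]; rewrite numulBr numulA ea eb.
    by rewrite subrr; split=> // x /CY Yx [].
  by rewrite subr0; split=> // x CDx; split; [exact: CX|exact: CY].
move=> _; right; rewrite numulBr numulA ea numul0l subr0.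
by split=> // x /CX nX [].
Qed.

Lemma indicatesU X a Y b :
  indicates X a -> indicates Y b -> indicates (X `|` Y) (a + b - a ** b).
Proof.
move=> [[C MC Ca] Xa] [[C' MC' C'b] Yb]; split.
  have MCC' := MU MC MC'; exists (C `|` C') => //.
  have CC'a := absorb_sub MC MCC' (@subsetUl _ C C') Ca.
  have CC'b := absorb_sub MC' MCC' (@subsetUr _ C C') C'b.
  by rewrite numulBr numulDr numulA CC'a CC'b.
apply: (dissected_decides2 Xa Yb) => {MC MC' Ca C'b}C {}C' D _.
move=> [[CX ea]|[CX ea]].
  move=> YCD; left; split; first by move=> x /CX; left.
  by rewrite numulBr numulDr numulA ea addrK.
move=> [[CY eb]|[CY eb]]; [left|right];
  rewrite numulBr numulDr numulA ea eb numul0l add0r subr0; split=> // x CDx.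
  by right; exact: CY.
by case; [exact: CX|exact: CY].
Qed.

End Extension.

(** * Leavitt path algebras over families of vertex sets *)

Section Leavitt.
Variables (R : comPzRingType) (G : ultragraph).

Section Projections.
Variable F : setFamily G.
Local Notation gen := (pres_gen (@leavitt_rel R G F)).

(** The projections p_A, as a total function on sets of vertices: this
    replaces the proofs of membership carried by the generators by side
    conditions. *)
Definition proj (A : set (vertex G)) : leavitt_path_algebra R F :=
  if pselect (members F A) is left FA then gen (GenP FA) else 0.

Lemma projE A (FA : members F A) : proj A = gen (GenP FA).
Proof.
by rewrite /proj; case: pselect => // FA'; rewrite (Prop_irrelevance FA' FA).
Qed.

Lemma proj0 : proj set0 = 0.
Proof. rewrite (projE (fam0 F)); exact: (pres_gen_rels (rel_p0 R F)). Qed.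

Lemma projI A B : members F A -> members F B ->
  proj A ** proj B = proj (A `&` B).
Proof.
move=> FA FB; rewrite (projE FA) (projE FB) (projE (famI FA FB)).
exact: (pres_gen_rels (rel_pI R FA FB)).
Qed.

Lemma projU A B : members F A -> members F B ->
  proj (A `|` B) = proj A + proj B - proj (A `&` B).
Proof.
move=> FA FB; rewrite (projE FA) (projE FB) (projE (famI FA FB)).
rewrite (projE (famU FA FB)); exact: (pres_gen_rels (rel_pU R FA FB)).
Qed.

Lemma projD A B : members F A -> members F B -> members F (A `\` B) ->
  proj (A `\` B) = proj A - proj A ** proj B.
Proof.
move=> FA FB FAB; have FI := famI FA FB.
have := projU FI FAB; rewrite setUIDK projI // => ->.
have -> : A `&` B `&` (A `\` B) = set0.
  by apply/seteqP; split=> // x [[_ ?] []].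
by rewrite proj0 subr0 addrC addKr.
Qed.

End Projections.

(** The relations involving edges mention projections of singletons and ranges
    only, and every family contains these sets; so they pass between
    assignments that agree on common generators.  Only the relations for
    intersections and unions depend on the family. *)
Lemma leavitt_rel_transfer (F F' : setFamily G) (L : nuAlgType R)
    (g : generator F -> L) (g' : generator F' -> L) :
  (forall t u, leavitt_rel t u -> eval g' t = eval g' u) ->
  (forall e, g (GenS F e) = g' (GenS F' e)) ->
  (forall e, g (GenSs F e) = g' (GenSs F' e)) ->
  (forall A (FA : members F A) (F'A : members F' A),
     g (GenP FA) = g' (GenP F'A)) ->
  (forall A B (FA : members F A) (FB : members F B),
     g (GenP FA) ** g (GenP FB) = g (GenP (famI FA FB))) ->
  (forall A B (FA : members F A) (FB : members F B),
     g (GenP (famU FA FB)) =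
     g (GenP FA) + g (GenP FB) - g (GenP (famI FA FB))) ->
  forall t u, leavitt_rel t u -> eval g t = eval g u.
Proof.
move=> rel' gS gSs gP gI gU _ _ [] //=.
- by rewrite (gP _ _ (fam0 F')); exact: (rel' _ _ (rel_p0 R F')).
- move=> e; rewrite (gP _ _ (fam1 F' _)) gS.
  exact: (rel' _ _ (rel_src_s R F' e)).
- move=> e; rewrite (gP _ _ (fam_rng F' _)) gS.
  exact: (rel' _ _ (rel_s_rng R F' e)).
- move=> e; rewrite (gP _ _ (fam_rng F' _)) gSs.
  exact: (rel' _ _ (rel_rng_ss R F' e)).
- move=> e; rewrite (gP _ _ (fam1 F' _)) gSs.
  exact: (rel' _ _ (rel_ss_src R F' e)).
- move=> e f; have := rel' _ _ (rel_ss_s R F' e f); rewrite gSs gS /=.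
  by case: ifP => _ /= ->; rewrite ?(gP _ _ (fam_rng F' _)).
- move=> v v0 vfin; have := rel' _ _ (rel_regular R F' v0 vfin).
  rewrite !eval_sum /= (gP _ _ (fam1 F' _)) => ->.
  by apply: eq_bigr => e _; rewrite gS gSs.
Qed.

End Leavitt.

(** * The isomorphism *)

Section Isomorphism.
Variables (R : comPzRingType) (G : ultragraph).

Local Notation pG0 := (proj R (famG0 G)).
Local Notation pB := (proj R (famB G)).
Local Notation indic := (indicates (@calG0 G) pG0).

Let indic_uniq := indicates_uniq (@calG0_0 G) (@calG0_U G) (@calG0_I G)
  (proj0 R (famG0 G)) (@projI R G (famG0 G)) (@projU R G (famG0 G)).
Let indic_member := indicates_member (@calG0_U G) (@calG0_I G)
  (@projI R G (famG0 G)).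
Let indicI := indicatesI (@calG0_U G) (@calG0_I G)
  (@projI R G (famG0 G)) (@projU R G (famG0 G)).
Let indicD := indicatesD (@calG0_U G) (@calG0_I G)
  (@projI R G (famG0 G)) (@projU R G (famG0 G)).
Let indicU := indicatesU (@calG0_U G) (@calG0_I G)
  (@projI R G (famG0 G)) (@projU R G (famG0 G)).

(** The projections of [LPA R G], extended from [calG0 G] to [calB G]. *)
Definition proj_ext (X : set (vertex G)) : LPA R G :=
  xget 0 [set a | indic X a].

Lemma proj_extE X a : indic X a -> proj_ext X = a.
Proof.
by move=> Xa; apply: xget_unique => // b Xb; exact: indic_uniq Xb Xa.
Qed.

Lemma proj_ext_calG0 A : calG0 A -> proj_ext A = pG0 A.
Proof. by move=> MA; apply/proj_extE/indic_member. Qed.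

(** The sets X in [calB G] for which a suitable [a] exists form a ring of sets
    containing [calG0 G].  The equation on [f a] goes through the same
    induction: in both algebras the operations on sets are given by the same
    formulas in the projections.  It yields that [f] inverts the extension. *)
Lemma calB_indicates (f : LPA R G -> LPAr R G) : nualg_hom f ->
  (forall A, calG0 A -> f (pG0 A) = pB A) ->
  forall X, calB X -> exists2 a, indic X a & f a = pB X.
Proof.
move=> fH fp.
suff sub : @calB G `<=`
    [set X | calB X /\ exists2 a, indic X a & f a = pB X].
  by move=> X /sub[].
have fM := fH.2.
apply: smallest_sub.
  split=> X Y [BX [a Xa fa]] [BY [b Yb fb]]; split.
  - exact: calB_D.
  - exists (a - a ** b); first exact: indicD.
    by rewrite nualg_homB // fM fa fb -projD //; exact: calB_D.
  - exact: calB_U.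
  - exists (a + b - a ** b); first exact: indicU.
    by rewrite nualg_homB // nualg_homD // fM fa fb projU // projI.
  - exact: calB_I.
  - exists (a ** b); first exact: indicI.
    by rewrite fM fa fb projI.
move=> A MA; split; first exact: calG0_calB.
by exists (pG0 A); [exact: indic_member | exact: fp].
Qed.

Definition incl_gen (x : generator (famG0 G)) : LPAr R G :=
  match x with
  | GenS e => pres_gen _ (GenS (famB G) e)
  | GenSs e => pres_gen _ (GenSs (famB G) e)
  | GenP A _ => pB A
  end.

Definition ext_gen (x : generator (famB G)) : LPA R G :=
  match x with
  | GenS e => pres_gen _ (GenS (famG0 G) e)
  | GenSs e => pres_gen _ (GenSs (famG0 G) e)
  | GenP X _ => proj_ext X
  end.

Lemma incl_gen_rels t u :
  leavitt_rel t u -> eval incl_gen t = eval incl_gen u.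
Proof.
apply: (leavitt_rel_transfer (@pres_gen_rels _ _ _)) => //=.
- by move=> A _ BA; rewrite projE.
- by move=> A B MA MB; rewrite projI //; exact: calG0_calB.
- by move=> A B MA MB; rewrite projU //; exact: calG0_calB.
Qed.

Lemma ext_gen_rels : (forall X, calB X -> exists a, indic X a) ->
  forall t u, leavitt_rel t u -> eval ext_gen t = eval ext_gen u.
Proof.
move=> ex.
have extP X : calB X -> indic X (proj_ext X) by move=> /ex; exact: xgetPex.
apply: (leavitt_rel_transfer (@pres_gen_rels _ _ _)) => //=.
- by move=> A _ MA; rewrite -projE; exact: proj_ext_calG0.
- by move=> A B BA BB; apply/esym/proj_extE/indicI; exact: extP.
- move=> A B BA BB; rewrite (proj_extE (indicI (extP _ BA) (extP _ BB))).
  by apply/proj_extE/indicU; exact: extP.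
Qed.

End Isomorphism.

Theorem proposition5p2 (R : comPzRingType) (G : ultragraph) :
  nualg_isomorphic (LPAr R G) (LPA R G).
Proof.
have [f [[fH fg] _]] := presAlg_universal (@incl_gen_rels R G).
have fp A : calG0 A -> f (proj R (famG0 G) A) = proj R (famB G) A.
  by move=> MA; rewrite (projE R (F := famG0 G) MA) fg.
have exB := calB_indicates fH fp.
have ex X : calB X -> exists a, indicates (@calG0 G) (proj R (famG0 G)) X a.
  by move=> /exB[a Xa _]; exists a.
have [h [[hH hg] _]] := presAlg_universal (ext_gen_rels ex).
exists h; split=> //; exists f.
  apply: (@nualg_hom_pres_id _ _ _ (f \o h)); first exact: nualg_hom_comp.
  case=> [e|e|X BX] /=; rewrite hg /= ?fg //.
  have [a Xa fa] := exB X BX.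
  by rewrite (proj_extE Xa) fa (projE R (F := famB G) BX).
apply: (@nualg_hom_pres_id _ _ _ (h \o f)); first exact: nualg_hom_comp.
case=> [e|e|A MA] /=; rewrite fg /= ?hg //.
rewrite (projE R (F := famB G) (calG0_calB MA)) hg /=.
by rewrite proj_ext_calG0 // (projE R (F := famG0 G) MA).
Qed.
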